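(* Let $\{X_n\}$ be an absorbing random leap on $\{0,\dots,N\}$ with $N\ge k_p+k_q$, and for $i\in\{0,\dots,N\}$ let $u_i=P(X_n=N\text{ for some }n\ge0\mid X_0=i)$. Then $\det(\mathbf A_N\mathbf Z)\neq0$ and \[ u_i=\frac{\det(\mathbf A_i\mathbf Z)}{\det(\mathbf A_N\mathbf Z)}\qquad\text{for every } i\in\{0,\dots,N\}. \]
   Context: Fix an integer $k\ge1$ and nonnegative reals $p_1,\dots,p_k,q_1,\dots,q_k$ with $\sum_{j=1}^k(p_j+q_j)=1$, $\sum_{j=1}^k p_j>0$ and $\sum_{j=1}^k q_j>0$. Let $k_p=\max\{j:p_j>0\}$ and $k_q=\max\{j:q_j>0\}$. Let $\xi$ be a random variable with $P(\xi=\ell)=p_\ell$ and $P(\xi=-\ell)=q_\ell$ for $1\le\ell\le k$. The simple random leap is the Markov chain on $\mathbb Z$ with $P(X_{n+1}=j\mid X_n=i)=P(\xi=j-i)$. For an integer $N\ge k_p+k_q$, the absorbing random leap is the Markov chain on $\{0,\dots,N\}$ in which $0$ and $N$ are absorbing and, for $0<i<N$: $P(i\to j)=P(i+\xi=j)$ for $1\le j\le N-1$, $P(i\to0)=P(i+\xi\le0)$, $P(i\to N)=P(i+\xi\ge N)$. Characteristic polynomial: $\chi(z)=\sum_{j=0}^{2k-1}c_jz^j$ where $c_j=-\sum_{\ell=k-j}^k q_\ell$ for $0\le j\le k-1$ and $c_j=\sum_{\ell=j-k+1}^k p_\ell$ for $k\le j\le 2k-1$. Counted with multiplicity, $\chi$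 has exactly $r:=k_p+k_q-1$ nonzero roots; let $z_1,\dots,z_s$ be the distinct nonzero roots with multiplicities $r_1,\dots,r_s$ ($\sum r_j=r$). For each $j$ let $\mathbf Z^{(j)}$ be the $(N+r-1)\times r_j$ matrix with entries $Z^{(j)}_{i,\ell}=(i+1-k_q)^{\ell-1}z_j^{\,i+1-k_q}$ ($1\le i\le N+r-1$, $1\le\ell\le r_j$), with the convention $0^0=1$, and let $\mathbf Z=(\mathbf Z^{(1)}\ \cdots\ \mathbf Z^{(s)})$, an $(N+r-1)\times r$ matrix. Accordion matrix: for $i\in\{0,\dots,N\}$, $\mathbf A_i$ is the $r\times(N+r-1)$ matrix whose first $k_q-1$ rows are the unit row vectors $\tilde e_1^T,\dots,\tilde e_{k_q-1}^T$, whose $k_q$-th row has ones in columns $k_q,\dots,k_q+i-1$ and zeros elsewhere, and whose last $k_p-1$ rows are the unit row vectors $\tilde e_{N+k_q}^T,\dots,\tilde e_{N+r-1}^T$ (here $\tilde e_m$ denotes the $m$-th unit vector of length $N+r-1$). In block form $\mathbf A_i=\begin{pmatrix}I_{k_q-1}&0&0&0\\0&\mathbf 1_i^T&\mathbf 0_{N-i}^T&0\\0&0&0&I_{k_p-1}\end{pmatrix}$. *)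

(* Defs.v *)
(* Scalars live in an archimedean numeric closed field C
   (e.g. the complex numbers, or algC); probabilities are elements x of C
   with 0 <= x (hence real). *)
From HB Require Import structures.
From mathcomp Require Import all_boot all_order all_algebra.
Set Implicit Arguments. Unset Strict Implicit. Unset Printing Implicit Defensive.
Import Order.TTheory GRing.Theory Num.Theory.
Local Open Scope ring_scope.

Section RandomLeap.
Variable C : archiClosedFieldType.
(* p j = p_j, q j = q_j; only the values for 1 <= j <= k are used. *)
Variables (k : nat) (p q : nat -> C).

Definition kp : nat := (\max_(1 <= j < k.+1 | (0 < p j)%R) j)%N.
Definition kq : nat := (\max_(1 <= j < k.+1 | (0 < q j)%R) j)%N.

Definition xi_prob (d : int) : C :=
  match d with
  | Posz 0 => 0
  | Posz n => if (n <= k)%N then p n else 0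
  | Negz n => if (n.+1 <= k)%N then q n.+1 else 0
  end.

Definition chi_coef (j : nat) : C :=
  if (j < k)%N then - \sum_((k - j)%N <= l < k.+1) q l
  else \sum_((j - k).+1 <= l < k.+1) p l.
Definition chi : {poly C} := \poly_(j < (2 * k)%N) chi_coef j.

Definition leap_trans (N : nat) : 'M[C]_(N.+1) :=
  \matrix_(i < N.+1, j < N.+1)
    if ((i == 0%N :> nat) || (i == N :> nat)) then (i == j)%:R
    else if (j == 0%N :> nat) then
      \sum_(1 <= l < k.+1 | ((i%:Z - l%:Z) <= 0)%R) xi_prob (- l%:Z)
      + \sum_(1 <= l < k.+1 | ((i%:Z + l%:Z) <= 0)%R) xi_prob (l%:Z)
    else if (j == N :> nat) then
      \sum_(1 <= l < k.+1 | ((N%:Z) <= i%:Z + l%:Z)%R) xi_prob (l%:Z)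
      + \sum_(1 <= l < k.+1 | ((N%:Z) <= i%:Z - l%:Z)%R) xi_prob (- l%:Z)
    else xi_prob (j%:Z - i%:Z).

(* u_i = P(X_n = N for some n | X_0 = i).  Since N is absorbing, the events
   {X_n = N} increase in n, so u_i = lim_n P(X_n = N | X_0 = i)
   = lim_n (T^n)_{i,N}. *)
Definition is_limit (a : nat -> C) (l : C) : Prop :=
  forall eps : C, 0 < eps -> exists n0 : nat, forall n : nat,
    (n0 <= n)%N -> `|a n - l| < eps.

Definition absorb_prob_is (N : nat) (i : 'I_N.+1) (u : C) : Prop :=
  is_limit (fun n => (leap_trans N ^+ n) i ord_max) u.

Definition rr : nat := (kp + kq).-1.

(* Accordion matrix A_i (0-based row a < r, column b < N+r-1):
   rows 0..kq-2 : unit vector e_{a+1} (0-based column a);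
   row kq-1     : ones in 1-based columns kq..kq+i-1;
   rows kq..r-1 : 1-based row kq+t has unit vector e_{N+kq+t-1},
                  i.e. 0-based column N + a - 1. *)
Definition accordion (N i : nat) : 'M[C]_(rr, N + rr - 1) :=
  \matrix_(a < rr, b < N + rr - 1)
    if (a < kq.-1)%N then (b == a :> nat)%:R
    else if (a == kq.-1 :> nat) then ((kq.-1 <= b) && (b < kq.-1 + i))%N%:R
    else (b == (N + a).-1 :> nat)%:R.

(* Columns of Z: for the list zs = [z_1;...;z_s] of distinct nonzero roots,
   column blocks j = 1..s, each with columns l = 1..r_j where
   r_j = mup z_j chi; represented 0-based as pairs (z_j, l-1). *)
Definition Zcols (zs : seq C) : seq (C * nat) :=
  flatten [seq [seq (z, l) | l <- iota 0 (mup z chi)] | z <- zs].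

(* Z_{i,l} = (i+1-kq)^(l-1) z^(i+1-kq) for 1-based row i; here 0-based
   row i0 = i - 1, so the exponent is i0 + 2 - kq (an integer). 0^0 = 1. *)
Definition Zmat (N : nat) (zs : seq C) : 'M[C]_(N + rr - 1, rr) :=
  \matrix_(i0 < N + rr - 1, c < rr)
    let zl := nth (0, 0%N) (Zcols zs) c in
    let e : int := (i0%:Z + 2%:Z - kq%:Z)%R in
    (e%:~R) ^+ zl.2 * zl.1 ^ e.

End RandomLeap.

(* Main.v *)
Require Import Defs.
From HB Require Import structures.
From mathcomp Require Import all_boot all_order all_algebra.
From mathcomp Require Import zify ring.
Import Order.TTheory GRing.Theory Num.Theory.
Local Open Scope ring_scope.

(* Let v be column kq - 1 of the adjugate of A_N Z.  The sequence d = Z v,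
   extended to all of int, is a combination of the sequences e^l z^e and hence
   solves the linear recurrence with characteristic polynomial chi; its partial
   sums u_i are, by Cramer, det (A_i Z).  The other rows of A_N force d to vanish
   near both ends, so u is harmonic for the absorbing chain, with u_0 = 0 and
   u_N = det (A_N Z).  The function M^i with M = 2 / sum p has drift at least 1
   at interior states, so the interior mass s_m after m steps satisfies
   m s_m <= M^N; hence T^m(i, N) u_N tends to u_i for every harmonic u with
   u_0 = 0.  The same limit gives uniqueness: a kernel vector of A_N Z yields
   u = 0, hence Z v = 0, and the columns of Z are free because they are dual to
   products of powers of (X - z) under the operators (X d/dX + e)^l. *)

(** * The Euler operator and linear independence of the sequences e^l z^e *)

Section EulerOperator.
Variable F : numFieldType.
Implicit Types (e : int) (f g : {poly F}) (z : F).

(** This is X^(-e) (X d/dX) X^e: each X^i is an eigenvector with eigenvalue i + e. In this form it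
    acts on polynomials for negative e as well. *)
Definition eulerD e f : {poly F} := 'X * f^`() + e%:~R *: f.

Lemma coef_iter_eulerD e l f i :
  (iter l (eulerD e) f)`_i = (i%:Z + e)%:~R ^+ l * f`_i.
Proof.
elim: l => [|l IHl]; first by rewrite expr0 mul1r.
rewrite iterS {1}/eulerD coefD coefXM coefZ exprS -mulrA -IHl intrD mulrDl.
by case: i {IHl} => [|i] /=; rewrite ?mul0r // coef_deriv mulr_natl.
Qed.

(** Turns the pairing of coefficients with the sequence e^l z^e into a value at z, so that
    orthogonality becomes a matter of root multiplicity. *)
Lemma horner_iter_eulerD e l f n z : z != 0 -> (size f <= n)%N ->
  \sum_(i < n) f`_i * ((i%:Z + e)%:~R ^+ l * z ^ (i%:Z + e)) =
  z ^ e * (iter l (eulerD e) f).[z].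
Proof.
move=> z0 szf; rewrite (@horner_coef_wide _ n).
  rewrite mulr_sumr; apply: eq_bigr => i _.
  rewrite coef_iter_eulerD expfzDr // -exprnP; ring.
apply/leq_sizeP => i ni; rewrite coef_iter_eulerD nth_default ?mulr0 //.
exact: leq_trans ni.
Qed.

(** One application costs one factor X - z, and no more when z and g(z) are nonzero: the new
    cofactor has value (m+1) z g(z) at z. *)
Lemma eulerD_XsubC_exp e z m g :
  eulerD e (('X - z%:P) ^+ m.+1 * g) =
  ('X - z%:P) ^+ m * (m.+1%:R *: ('X * g) + ('X - z%:P) * eulerD e g).
Proof.
rewrite /eulerD derivM deriv_exp derivXsubC mul1r exprS /= -!mul_polyC -mulr_natl polyC_natr.
ring.
Qed.

Lemma horner_iter_eulerD_eq0 e z f l m :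
  ('X - z%:P) ^+ m %| f -> (l < m)%N -> (iter l (eulerD e) f).[z] = 0.
Proof.
elim: l m f => [|l IHl] [|m] // f /dvdpP[g ->] lm.
  by rewrite /= exprS !hornerM hornerXsubC subrr mul0r mulr0.
rewrite iterSr; apply: (IHl m) => //.
by rewrite mulrC eulerD_XsubC_exp dvdp_mulr.
Qed.

Lemma horner_iter_eulerD_neq0 e z g l : z != 0 -> g.[z] != 0 ->
  (iter l (eulerD e) (('X - z%:P) ^+ l * g)).[z] != 0.
Proof.
move=> z0; elim: l g => [|l IHl] g gz; first by rewrite expr0 mul1r.
rewrite iterSr eulerD_XsubC_exp; apply: IHl.
by rewrite hornerD hornerZ !hornerM hornerX hornerXsubC subrr mul0r addr0 !mulf_neq0 // pnatr_eq0.
Qed.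

Lemma size_prod_XsubC_exp (s : seq F) (P : pred F) (m : F -> nat) :
  size (\prod_(z <- s | P z) ('X - z%:P) ^+ m z) = (\sum_(z <- s | P z) m z).+1.
Proof.
elim: s => [|z s IHs]; first by rewrite !big_nil size_poly1.
rewrite !big_cons; case: (P z) => //.
rewrite size_mul ?IHs ?size_exp_XsubC ?addSn ?addnS //.
  by rewrite expf_neq0 // polyXsubC_eq0.
by rewrite -size_poly_eq0 IHs.
Qed.

(* [Zcols k p q zs] is this for [m z := mup z (chi k p q)], by conversion. *)
Definition expo_cols (m : F -> nat) (s : seq F) : seq (F * nat) :=
  flatten [seq [seq (z, l) | l <- iota 0 (m z)] | z <- s].

Lemma size_expo_cols m s : size (expo_cols m s) = (\sum_(z <- s) m z)%N.
Proof.
rewrite /expo_cols size_flatten /shape -map_comp sumnE big_map.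
by apply: eq_bigr => z _; rewrite /= size_map size_iota.
Qed.

Lemma mem_expo_cols m s zl :
  (zl \in expo_cols m s) = (zl.1 \in s) && (zl.2 < m zl.1)%N.
Proof.
apply/flatten_mapP/andP => [[z zs /mapP[l]]|].
  by rewrite mem_iota => /andP[_ lm] ->.
case: zl => z l /= [zs lm]; exists z => //.
by apply/mapP; exists l; rewrite ?mem_iota.
Qed.

Lemma uniq_expo_cols m s : uniq s -> uniq (expo_cols m s).
Proof.
move=> us; rewrite /expo_cols; apply: allpairs_uniq_dep => //.
- by move=> x _; rewrite iota_uniq.
- by move=> [x l] [y l'] _ _ [-> ->].
Qed.

(* Pairing the sequence with the coefficients of
   (X - z0)^l0 * prod_(z != z0) (X - z)^(m z) annihilates every column except
   (z0, l0) and the columns (z0, l) with l > l0. *)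
Lemma expo_cols_free (m : F -> nat) (s : seq F) n (v : 'I_n -> F) e :
  uniq s -> 0 \notin s -> size (expo_cols m s) = n ->
  (forall i : nat, (i < n)%N ->
     \sum_(c < n) v c * ((i%:Z + e)%:~R ^+ (nth (0, 0%N) (expo_cols m s) c).2
                         * (nth (0, 0%N) (expo_cols m s) c).1 ^ (i%:Z + e)) = 0) ->
  forall c, v c = 0.
Proof.
move=> us s0 szc Hv c1; apply/eqP; apply/negPn/negP => vc1.
set col := fun c : 'I_n => nth (0, 0%N) (expo_cols m s) c.
have colP c : (col c).1 \in s /\ ((col c).2 < m (col c).1)%N.
  have : col c \in expo_cols m s by rewrite mem_nth // szc.
  by rewrite mem_expo_cols => /andP.
have col0 c : (col c).1 != 0.
  by apply: contraNneq s0 => <-; case: (colP c).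
(* Among the columns with the root of c1 and a nonzero coefficient, c0 has the largest power l0. The
   columns (z0, l) with l > l0 thus have coefficient 0, and the pairing with f isolates v c0. *)
pose P c := (v c != 0) && ((col c).1 == (col c1).1).
have Pc1 : P c1 by rewrite /P vc1 eqxx.
case: (arg_maxnP (fun c => (col c).2) Pc1) => c0 /andP[vc0 /eqP zc0] Hmax.
set z0 := (col c1).1 in zc0 P Pc1 Hmax; set l0 := (col c0).2 in Hmax.
pose g := \prod_(z <- s | z != z0) ('X - z%:P) ^+ m z.
pose f := ('X - z0%:P) ^+ l0 * g.
have z0s : z0 \in s by case: (colP c1).
have l0m : (l0 < m z0)%N by rewrite -zc0; case: (colP c0).
have g0 : g != 0 by rewrite -size_poly_eq0 size_prod_XsubC_exp.
(* Since l0 < m z0, the degree of f is below n, the sum of all m z; the n given equations reach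
   every coefficient of f. *)
have szf : (size f <= n)%N.
  rewrite size_mul ?expf_neq0 ?polyXsubC_eq0 // size_exp_XsubC.
  rewrite size_prod_XsubC_exp -szc size_expo_cols (bigD1_seq z0) //=.
  by rewrite addnS -addSn leq_add2r.
have gz0 : g.[z0] != 0.
  rewrite horner_prod prodf_seq_neq0; apply/allP => z _; apply/implyP => zz0.
  by rewrite horner_exp hornerXsubC expf_neq0 // subr_eq0 eq_sym.
have : \sum_(i < n) f`_i * \sum_(c < n) v c *
    ((i%:Z + e)%:~R ^+ (col c).2 * (col c).1 ^ (i%:Z + e)) = 0.
  by apply: big1 => i _; rewrite Hv ?mulr0.
under eq_bigr do rewrite mulr_sumr.
rewrite exchange_big /=.
have E c : \sum_(i < n) f`_i * (v c *
    ((i%:Z + e)%:~R ^+ (col c).2 * (col c).1 ^ (i%:Z + e))) =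
    v c * ((col c).1 ^ e * (iter (col c).2 (eulerD e) f).[(col c).1]).
  rewrite -(horner_iter_eulerD _ _ _ _ _ (col0 c) szf) mulr_sumr.
  by apply: eq_bigr => i _; rewrite mulrCA.
under eq_bigr do rewrite E.
rewrite (bigD1 c0) //= big1 ?addr0 => [/eqP|c cc0].
  rewrite !mulf_eq0 (negPf vc0) expfz_eq0 (negPf (col0 c0)) andbF /= zc0.
  have z00 : z0 != 0 := col0 c1.
  by rewrite (negPf (horner_iter_eulerD_neq0 e z0 g l0 z00 gz0)).
have [->|vc] := eqVneq (v c) 0; first by rewrite mul0r.
have [zs lm] := colP c.
have [zc|zc] := eqVneq (col c).1 z0; last first.
  rewrite (@horner_iter_eulerD_eq0 _ _ _ _ (m (col c).1)) ?mulr0 //.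
  apply/dvdp_mull; rewrite /g -big_filter (big_rem (col c).1) /=.
    exact/dvdp_mulr/dvdpp.
  by rewrite mem_filter zc.
rewrite (@horner_iter_eulerD_eq0 _ _ _ _ l0) ?mulr0 //.
  by rewrite zc; apply/dvdp_mulr/dvdpp.
have le : ((col c).2 <= l0)%N by apply: Hmax; rewrite /P vc zc eqxx.
rewrite ltn_neqAle le andbT; apply: contra_neq cc0 => ll.
apply: val_inj; apply/eqP; rewrite -(nth_uniq (0, 0%N) _ _ (uniq_expo_cols m _ us)); try by rewrite szc; apply: ltn_ord.
by apply/eqP/injective_projections; rewrite -/(col c) -/(col c0) ?zc ?zc0.
Qed.

End EulerOperator.

Lemma mulmx_col (R : pzSemiRingType) m n (A : 'M[R]_(m, n)) (f : 'I_n -> R) i j :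
  (A *m \col_l f l) i j = \sum_l A i l * f l.
Proof. by rewrite mxE; apply: eq_bigr => l _; rewrite mxE. Qed.

(** * Iterates of a nonnegative matrix *)

Section NonnegativeMatrix.
Variables (R : numDomainType) (n : nat) (T : 'M[R]_n.+1).
Hypothesis T_ge0 : forall i j, 0 <= T i j.

Lemma exp_mx_ge0 m i j : 0 <= (T ^+ m) i j.
Proof.
elim: m i j => [|m IHm] i j; first by rewrite expr0 mxE ler0n.
by rewrite exprS mxE sumr_ge0 // => l _; rewrite mulr_ge0.
Qed.

Lemma exp_mx_le m (f g : 'cV[R]_n.+1) i :
  (forall j, f j 0 <= g j 0) -> (T ^+ m *m f) i 0 <= (T ^+ m *m g) i 0.
Proof.
by move=> fg; rewrite !mxE ler_sum // => j _; rewrite ler_wpM2l // exp_mx_ge0.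
Qed.

Lemma exp_mxSr m (f : 'cV[R]_n.+1) : T ^+ m.+1 *m f = T ^+ m *m (T *m f).
Proof. by rewrite exprSr mulmxA. Qed.

(* The values T^j s decrease with j, and T^m g >= g + sum_(j < m) T^j s. *)
Lemma lyapunov_bound (g s : 'cV[R]_n.+1) (G : R) m i :
  (forall j, 0 <= g j 0 <= G) -> (forall j, 0 <= s j 0) ->
  (forall j, g j 0 + s j 0 <= (T *m g) j 0) ->
  (forall j, (T *m s) j 0 <= s j 0) ->
  T *m const_mx G = const_mx G :> 'cV[R]_n.+1 ->
  (T ^+ m *m s) i 0 *+ m <= G.
Proof.
move=> g_bd s_ge0 drift s_dec TG.
(* The constant vector G dominates g and is fixed by T, hence dominates every iterate of g. *)
have Tm_le l : (T ^+ l *m g) i 0 <= G.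
  have -> : G = (T ^+ l *m const_mx G : 'cV[R]_n.+1) i 0.
    elim: l => [|l IHl]; first by rewrite expr0 mul1mx mxE.
    by rewrite exp_mxSr TG.
  by apply: exp_mx_le => j; rewrite mxE; case/andP: (g_bd j).
apply: le_trans (Tm_le m).
suff: g i 0 + (T ^+ m *m s) i 0 *+ m <= (T ^+ m *m g) i 0.
  by apply: le_trans; rewrite lerDr; case/andP: (g_bd i).
elim: m => [|m IHm]; first by rewrite mulr0n addr0 expr0 mul1mx.
have s_step : (T ^+ m.+1 *m s) i 0 <= (T ^+ m *m s) i 0.
  by rewrite exp_mxSr exp_mx_le.
have : (T ^+ m *m (g + s)) i 0 <= (T ^+ m.+1 *m g) i 0.
  by rewrite exp_mxSr exp_mx_le // => j; rewrite mxE.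
apply: le_trans; rewrite mulmxDr [leRHS]mxE.
apply: le_trans (lerD IHm s_step); rewrite -addrA lerD2l mulrSr lerD2r.
exact: ler_wMn2r.
Qed.

End NonnegativeMatrix.

Lemma sum_nat_delta (R : pzSemiRingType) (f : nat -> R) a b m :
  \sum_(a <= l < b) f l * (l == m)%:R = if (a <= m < b)%N then f m else 0.
Proof.
case: ifP => Hm.
  rewrite (bigD1_seq m) ?mem_index_iota ?iota_uniq //= eqxx mulr1 big1 ?addr0 //.
  by move=> l /negPf ->; rewrite mulr0.
rewrite big_nat_cond big1 // => l; rewrite andbT => Hl.
have [lm|_] := eqVneq l m; last by rewrite mulr0.
by rewrite lm Hm in Hl.
Qed.

Lemma sum_ord_delta (R : comPzSemiRingType) n (f : nat -> R) m : (m < n)%N ->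
  \sum_(b < n) (b == m :> nat)%:R * f b = f m.
Proof.
move=> mn; under eq_bigr do rewrite mulrC.
by rewrite -(big_mkord xpredT (fun b => f b * (b == m)%:R)) sum_nat_delta mn.
Qed.

(** * The absorbing chain and the limit of its transition powers *)

Section RandomLeapChain.
Variables (C : archiClosedFieldType) (k : nat) (p q : nat -> C) (N : nat).

Notation T := (leap_trans k p q N).

Lemma xi_prob_pos l : (1 <= l < k.+1)%N -> xi_prob k p q l%:Z = p l.
Proof. by case: l => // l; rewrite /= ltnS => ->. Qed.

Lemma xi_prob_neg l : (1 <= l < k.+1)%N -> xi_prob k p q (- l%:Z) = q l.
Proof. by case: l => // l; rewrite -NegzE /= ltnS => ->. Qed.

(** Clamping the target with [minn] and truncated subtraction merges the boundary and interior cases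
    into one formula. *)
Lemma leap_transE (i j : 'I_N.+1) : (0 < i < N)%N ->
  T i j = \sum_(1 <= l < k.+1) (p l * (minn (i + l) N == j)%:R
                                + q l * ((i - l)%N == j)%:R).
Proof.
move=> /andP[i0 iN]; rewrite mxE gtn_eqF // ltn_eqF //= big_split /=.
have big_nat0 (P : pred nat) (f : nat -> C) :
    (forall l, (1 <= l < k.+1)%N -> P l = false) ->
    \sum_(1 <= l < k.+1 | P l) f l = 0.
  by move=> P0; rewrite big_nat_cond big_pred0 // => l; case: andP => // -[/P0->].
have sum0 (P : pred nat) (f : nat -> C) :
    (forall l, (1 <= l < k.+1)%N -> P l = false) ->
    \sum_(1 <= l < k.+1) f l * (P l)%:R = 0.
  by move=> P0; rewrite big_nat big1 // => l /P0 ->; rewrite mulr0.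
have sumP (P Q : pred nat) (f g : nat -> C) :
    (forall l, (1 <= l < k.+1)%N -> P l = Q l /\ f l = g l) ->
    \sum_(1 <= l < k.+1 | P l) f l = \sum_(1 <= l < k.+1) g l * (Q l)%:R.
  move=> PQ; rewrite big_mkcond; apply: eq_big_nat => l /PQ[-> ->].
  by case: (Q l); rewrite ?mulr0 ?mulr1.
have [j0|j0] := eqVneq (j : nat) 0%N.
  rewrite j0 [in LHS]addrC big_nat0 ?add0r; last by move=> l; lia.
  rewrite [in RHS]sum0 ?add0r; last by move=> l; lia.
  by apply: sumP => l Hl; split; [lia | rewrite xi_prob_neg].
have [jN|jN] := eqVneq (j : nat) N.
  rewrite jN [X in _ + X = _]big_nat0 ?addr0; last by move=> l; lia.
  rewrite [X in _ = _ + X]sum0 ?addr0; last by move=> l; lia.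
  by apply: sumP => l Hl; split; [lia | apply: xi_prob_pos].
have jN' := ltn_ord j.
case: (ltngtP i j) => ij.
- rewrite [X in _ = _ + X]sum0 ?addr0; last by move=> l; lia.
  under eq_big_nat => l Hl.
    have -> : (minn (i + l) N == j) = (l == j - i)%N by lia.
    over.
  rewrite sum_nat_delta (subzn (ltnW ij)).
  have -> : (1 <= j - i < k.+1)%N = (j - i <= k)%N by lia.
  by case: (j - i)%N (subn_gt0 i j) => //; rewrite ij.
- rewrite [X in _ = X + _]sum0 ?add0r; last by move=> l; lia.
  under eq_big_nat => l Hl.
    have -> : ((i - l)%N == j) = (l == i - j)%N by lia.
    over.
  rewrite sum_nat_delta -opprB (subzn (ltnW ij)).
  have -> : (1 <= i - j < k.+1)%N = (i - j <= k)%N by lia.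
  by case: (i - j)%N (subn_gt0 j i) => [|m _]; rewrite ?ij // -NegzE.
- rewrite ij subrr !sum0 ?addr0 // => l; lia.
Qed.

Lemma leap_trans_sum (f : nat -> C) (i : 'I_N.+1) : (0 < i < N)%N ->
  \sum_j T i j * f j =
  \sum_(1 <= l < k.+1) (p l * f (minn (i + l) N) + q l * f (i - l)%N).
Proof.
move=> Hi; have sum1 m : (m < N.+1)%N -> \sum_(j < N.+1) (m == j)%:R * f j = f m.
  move=> Hm; rewrite (bigD1 (Ordinal Hm)) //= eqxx mul1r big1 ?addr0 //.
  by move=> j; rewrite -val_eqE eq_sym => /negPf /= ->; rewrite mul0r.
under eq_bigr => j _ do rewrite leap_transE // mulr_suml.
rewrite exchange_big; apply: eq_big_nat => l Hl.
under eq_bigr => j _ do rewrite mulrDl -!mulrA.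
rewrite big_split /= -!mulr_sumr !sum1 //; lia.
Qed.

Lemma leap_trans_absorbing (f : nat -> C) (i : 'I_N.+1) : ~~ (0 < i < N)%N ->
  \sum_j T i j * f j = f i.
Proof.
move=> Hi; have iN := ltn_ord i.
have Hi' : (i == 0%N :> nat) || (i == N :> nat) by lia.
rewrite (bigD1 i) //= mxE Hi' eqxx mul1r big1 ?addr0 // => j ji.
by rewrite mxE Hi' eq_sym (negPf ji) mul0r.
Qed.

Hypothesis pq_ge0 : forall j : nat, (1 <= j <= k)%N -> 0 <= p j /\ 0 <= q j.
Hypothesis pq_sum : \sum_(1 <= j < k.+1) (p j + q j) = 1.
Hypothesis p_sum : 0 < \sum_(1 <= j < k.+1) p j.

Lemma leap_trans_ge0 i j : 0 <= T i j.
Proof.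
case: (boolP (0 < i < N)%N) => Hi; last first.
  have iN := ltn_ord i; rewrite mxE.
  have -> : (i == 0%N :> nat) || (i == N :> nat) by lia.
  exact: ler0n.
rewrite leap_transE // big_nat sumr_ge0 // => l Hl.
by have [pl ql] := pq_ge0 l Hl; rewrite addr_ge0 ?mulr_ge0.
Qed.

Lemma leap_trans_const (c : C) : T *m const_mx c = const_mx c :> 'cV[C]_N.+1.
Proof.
have -> : const_mx c = \col_(l < N.+1) c by apply/matrixP => i j; rewrite !mxE.
apply/matrixP => i j; rewrite mulmx_col mxE.
case: (boolP (0 < i < N)%N) => Hi; last exact: (leap_trans_absorbing (fun=> c)).
rewrite (leap_trans_sum (fun=> c)) // -[RHS]mul1r -pq_sum mulr_suml.
by apply: eq_bigr => l _; rewrite mulrDl.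
Qed.

(* From an interior state the chain moves up at least one step with
   probability P = sum p, so (2/P)^i has drift at least 1 there. *)
Lemma interior_mass_bound : exists2 G : C, 0 <= G &
  forall m i, (T ^+ m *m (\col_j (0 < j < N)%N%:R)) i 0 *+ m <= G.
Proof.
pose P := \sum_(1 <= j < k.+1) p j; have P0 : 0 < P := p_sum.
have q_sum : 0 <= \sum_(1 <= j < k.+1) q j.
  by rewrite big_nat sumr_ge0 // => l Hl; have [] := pq_ge0 l Hl.
have P1 : P <= 1 by rewrite -pq_sum big_split /= lerDl.
pose M := 2 / P.
have MP : P * M = 2 by rewrite /M mulrC divfK // gt_eqF.
have M1 : 1 <= M.
  by rewrite /M ler_pdivlMr // mul1r (le_trans P1) // ler1n.
have M0 : 0 <= M by apply: le_trans M1.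
exists (M ^+ N); first exact: exprn_ge0.
move=> m i; apply: (@lyapunov_bound _ _ _ leap_trans_ge0 (\col_j M ^+ j)).
- move=> j; rewrite mxE exprn_ge0 //= ler_weXn2l //.
  by rewrite -ltnS.
- by move=> j; rewrite mxE ler0n.
- move=> j; rewrite mulmx_col !mxE.
  case: (boolP (0 < j < N)%N) => Hj; last first.
    by rewrite addr0 (leap_trans_absorbing (fun x => M ^+ x)).
  rewrite (leap_trans_sum (fun x => M ^+ x)) // big_split /=.
  (* An upward jump from an interior j, even cut off at N, ends at j + 1 or higher. The upward part
     is therefore at least P M^(j+1) = 2 M^j >= M^j + 1. *)
  apply: (@le_trans _ _ (P * M ^+ j.+1)).
    by rewrite exprS mulrA MP mulr2n mulrDl mul1r lerD2l exprn_ege1.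
  rewrite -[leLHS]addr0 lerD //; last first.
    rewrite big_nat sumr_ge0 // => l Hl; have [_ ql] := pq_ge0 l Hl.
    by rewrite mulr_ge0 // exprn_ge0.
  rewrite mulr_suml !big_nat ler_sum // => l Hl; have [pl _] := pq_ge0 l Hl.
  by rewrite ler_wpM2l // ler_weXn2l //; lia.
- move=> j; rewrite mulmx_col !mxE.
  case: (boolP (0 < j < N)%N) => Hj; last first.
    by rewrite (leap_trans_absorbing (fun x => (0 < x < N)%N%:R)) // (negPf Hj).
  rewrite (leap_trans_sum (fun x => (0 < x < N)%N%:R)) //=.
  apply: (@le_trans _ _ (\sum_(1 <= l < k.+1) (p l + q l))); last by rewrite pq_sum.
  rewrite !big_nat ler_sum // => l Hl; have [pl ql] := pq_ge0 l Hl.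
  by rewrite lerD // ler_piMr // lern1 leq_b1.
- exact: leap_trans_const.
Qed.

(** The powers of T fix u, so the error is the contribution of the states other than N. State 0
    contributes nothing because u 0 = 0, and the interior mass after m steps is at most G / m. *)
Lemma harmonic_limit (u : nat -> C) (i : 'I_N.+1) :
  u 0%N = 0 ->
  (forall j : 'I_N.+1, \sum_l T j l * u l = u j) ->
  is_limit (fun m => (T ^+ m) i ord_max * u N) (u i).
Proof.
move=> u0 Tu eps eps0; have [G G0 HG] := interior_mass_bound.
pose K := \sum_(j < N.+1) `|u j|.
have K0 : 0 <= K by rewrite sumr_ge0.
have Tmu m : T ^+ m *m (\col_j u j) = \col_j u j.
  elim: m => [|m IHm]; first by rewrite expr0 mul1mx.
  rewrite exp_mxSr (_ : T *m _ = \col_j u j) //.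
  by apply/matrixP => j l; rewrite mulmx_col Tu mxE.
(* Beyond this index K G / m < eps; the successor makes m positive at once. *)
exists (Num.bound (K * G / eps)).+1 => m Hm.
have m0 : 0 < m%:R :> C by rewrite ltr0n; apply: leq_trans Hm.
set s := \col_j (0 < j < N)%N%:R in HG.
have : `|(T ^+ m) i ord_max * u N - u i| <= K * (T ^+ m *m s) i 0.
  have -> : u i = (T ^+ m *m (\col_j u j)) i 0 by rewrite Tmu mxE.
  rewrite !mulmx_col (bigD1 ord_max) //= opprD addrA subrr add0r normrN.
  rewrite mulr_sumr [leRHS](bigD1 ord_max) //= ltnn andbF !mulr0 add0r.
  apply: le_trans (ler_norm_sum _ _ _) _; apply: ler_sum => j jN.
  have Tij : 0 <= (T ^+ m) i j by apply: exp_mx_ge0; apply: leap_trans_ge0.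
  rewrite normrM (ger0_norm Tij) mulrCA ler_wpM2l //.
  have [j0|j0] := posnP j; first by rewrite j0 u0 normr0 mulr0.
  have -> : (j < N)%N by rewrite ltn_neqAle -ltnS ltn_ord andbT.
  by rewrite mulr1 /K (bigD1 j) //= lerDl sumr_ge0.
move/le_lt_trans; apply.
rewrite -(ltr_pM2r m0) -mulrA mulr_natr.
apply: le_lt_trans (ler_wpM2l K0 (HG m i)) _.
rewrite [ltRHS]mulrC -ltr_pdivrMr //.
have KG0 : 0 <= K * G / eps by rewrite !mulr_ge0 // invr_ge0 ltW.
apply: lt_le_trans (archi_boundP KG0) _.
by rewrite ler_nat ltnW.
Qed.

End RandomLeapChain.

(** * Extremal indices, root counting and summation by parts *)

Lemma bigmax_pos_spec (R : numDomainType) k (f : nat -> R) :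
  (forall j, (1 <= j <= k)%N -> 0 <= f j) -> 0 < \sum_(1 <= j < k.+1) f j ->
  let m := (\max_(1 <= j < k.+1 | (0 < f j)%R) j)%N in
  [/\ (1 <= m <= k)%N, 0 < f m & forall j, (m < j <= k)%N -> f j = 0].
Proof.
move=> f0 fs m.
have fgt j : (m < j <= k)%N -> f j = 0.
  move=> /andP[mj jk]; have j0 : (0 < j)%N := leq_ltn_trans (leq0n m) mj.
  apply/eqP; apply: contraLR mj => fj; rewrite -leqNgt.
  apply: (@leq_bigmax_seq _ _ _ id); first by rewrite mem_index_iota j0.
  by rewrite lt_def fj f0 // j0.
(* A maximum over no index is 0; otherwise it is attained. The value 0 would force f to vanish on
   1..k, against the positive sum. *)
have : m = 0%N \/ ((1 <= m <= k)%N && (0 < f m)).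
  rewrite /m big_seq_cond; apply: (big_ind (fun x => x = 0%N \/ ((1 <= x <= k)%N && (0 < f x))))
    => [|x y Hx Hy|j]; first by left.
    by rewrite /maxn; case: ifP.
  by rewrite mem_index_iota => /andP[Hj fj]; right; rewrite fj andbT; lia.
case=> [m0|/andP[mk fm]]; last by split.
move: fs; rewrite big_nat big1 ?ltxx // => j Hj; apply: fgt; lia.
Qed.

Lemma sum_count_mem (T : eqType) (s t : seq T) :
  uniq t -> (\sum_(z <- t) count_mem z s = count (mem t) s)%N.
Proof.
move=> ut; elim: s => [|y s IHs] /=; first by rewrite big1.
rewrite big_split /= IHs; congr (_ + _)%N.
rewrite -(count_uniq_mem _ ut) -sum1_count [RHS]big_mkcond /=.
by apply: eq_bigr => z _; rewrite eq_sym; case: eqP.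
Qed.

(** Over a closed field f splits, so all multiplicities add up to the degree; that of 0 is counted
    apart because [s] omits 0. *)
Lemma sum_mup_nonzero (F : closedFieldType) (f : {poly F}) (s : seq F) :
  f != 0 -> uniq s -> (forall z, (z \in s) = (z != 0) && root f z) ->
  (\sum_(z <- s) mup z f + mup 0 f = (size f).-1)%N.
Proof.
move=> f0 us Hs; have [r Hr] := closed_field_poly_normal f.
have lf : lead_coef f != 0 by rewrite lead_coef_eq0.
have mupE z : mup z f = count_mem z r.
  by rewrite Hr -mul_polyC mupMr ?mu_prod_XsubC // rootC.
have rootE z : root f z = (z \in r) by rewrite Hr rootZ // root_prod_XsubC.
under eq_bigr do rewrite mupE.
rewrite sum_count_mem // mupE Hr size_scale // size_prod_XsubC /=.
rewrite -[RHS](count_predC (pred1 (0 : F))) addnC; congr (_ + _)%N.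
by apply: eq_in_count => z zr; rewrite /= Hs rootE zr andbT.
Qed.

Lemma summation_by_parts (R : pzRingType) (a F : nat -> R) k :
  \sum_(1 <= l < k.+1) a l * \sum_(m < l) F m =
  \sum_(m < k) (\sum_(m.+1 <= l < k.+1) a l) * F m.
Proof.
elim: k => [|k IHk]; first by rewrite big_geq // big_ord0.
rewrite big_nat_recr //= IHk !big_ord_recr /= big_nat1 mulrDr addrA.
congr (_ + _); rewrite mulr_sumr -big_split /=; apply: eq_bigr => m _.
by rewrite -mulrDl -big_nat_recr //= ltnS ltnW.
Qed.

(** * The characteristic polynomial and its recurrence *)

Section CharacteristicPolynomial.
Variables (C : archiClosedFieldType) (k : nat) (p q : nat -> C).
Hypothesis pq_ge0 : forall j : nat, (1 <= j <= k)%N -> 0 <= p j /\ 0 <= q j.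
Hypothesis p_sum : 0 < \sum_(1 <= j < k.+1) p j.
Hypothesis q_sum : 0 < \sum_(1 <= j < k.+1) q j.

Notation kp := (kp k p).
Notation kq := (kq k q).
Notation chi := (chi k p q).

Lemma kp_spec :
  [/\ (1 <= kp <= k)%N, 0 < p kp & forall j, (kp < j <= k)%N -> p j = 0].
Proof. by apply: bigmax_pos_spec => // j /pq_ge0[]. Qed.

Lemma kq_spec :
  [/\ (1 <= kq <= k)%N, 0 < q kq & forall j, (kq < j <= k)%N -> q j = 0].
Proof. by apply: bigmax_pos_spec => // j /pq_ge0[]. Qed.

Lemma size_chi : size chi = (k + kp)%N.
Proof.
have [kpk pkp p0] := kp_spec; apply/eqP; rewrite eqn_leq; apply/andP; split.
  apply/leq_sizeP => j Hj; rewrite coef_poly; case: ifP => // j2k.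
  rewrite /chi_coef ltnNge (_ : k <= j)%N /=; last lia.
  by rewrite big_nat big1 // => l Hl; apply: p0; lia.
have -> : (k + kp = (k + kp).-1.+1)%N by lia.
rewrite ltnNge; apply/negP => /leq_sizeP/(_ _ (leqnn _))/eqP; apply/negP.
rewrite coef_poly (_ : _ < _)%N; last lia.
rewrite /chi_coef ltnNge (_ : k <= _)%N /=; last lia.
rewrite (_ : _.+1 = kp); last lia.
rewrite big_ltn; last lia.
by rewrite big_nat big1 ?addr0 ?gt_eqF // => l Hl; apply: p0; lia.
Qed.

(** The lowest k - kq coefficients are tails of q beyond kq, hence 0, and the next one is - q kq,
    which is nonzero. *)
Lemma mup0_chi : mup 0 chi = (k - kq)%N.
Proof.
have [kqk qkq q0] := kq_spec.
have take0 : take_poly (k - kq) chi = 0.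
  apply/polyP => j; rewrite coef_take_poly coef0; case: ifP => // Hj.
  rewrite coef_poly; case: ifP => // _; rewrite /chi_coef ifT; last lia.
  by rewrite big_nat big1 ?oppr0 // => l Hl; apply: q0; lia.
rewrite -(poly_take_drop (k - kq) chi) take0 add0r mupMr.
  by rewrite -['X]subr0 -polyC0 mup_XsubCX eqxx.
rewrite rootE horner_coef0 coef_drop_poly add0n coef_poly ifT; last lia.
rewrite /chi_coef ifT; last lia.
rewrite (_ : (k - (k - kq) = kq)%N); last lia.
rewrite big_ltn; last lia.
by rewrite big_nat big1 ?addr0 ?oppr_eq0 ?gt_eqF // => l Hl; apply: q0; lia.
Qed.

(** The degree k + kp - 1 minus the multiplicity k - kq of the root 0 is kp + kq - 1. Hence [Zmat]
    never reads the default of [nth]. *)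
Lemma size_Zcols (zs : seq C) : uniq zs ->
  (forall z : C, (z \in zs) = (z != 0) && root chi z) ->
  size (Zcols k p q zs) = rr k p q.
Proof.
move=> us Hzs; have [kpk _ _] := kp_spec; have [kqk _ _] := kq_spec.
have chi0 : chi != 0 by rewrite -size_poly_gt0 size_chi; lia.
have := @sum_mup_nonzero _ _ _ chi0 us Hzs.
rewrite -(size_expo_cols _ (fun z => mup z chi)) mup0_chi size_chi /rr => H.
by apply/eqP; rewrite -(eqn_add2r (k - kq)%N); apply/eqP; apply: etrans H _; lia.
Qed.

(** The coefficients of chi are tail sums of p and q. With d e = u e - u (e - 1), Abel summation
    turns the recurrence into the mean change of u over one free leap from i. *)
Lemma sum_chi_coef (d : int -> C) (i : nat) :
  \sum_(j < (2 * k)%N) chi_coef k p q j * d (i%:Z + j%:Z + 1 - k%:Z) =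
  \sum_(1 <= l < k.+1) (p l * \sum_(m < l) d (i%:Z + m%:Z + 1)
                        - q l * \sum_(m < l) d (i%:Z - m%:Z)).
Proof.
rewrite mul2n -addnn big_split_ord /= addrC big_split /= sumrN.
rewrite (summation_by_parts _ p (fun m => d (i%:Z + m%:Z + 1))).
rewrite (summation_by_parts _ q (fun m => d (i%:Z - m%:Z))).
congr (_ + _).
  apply: eq_bigr => m _; rewrite /chi_coef ltnNge leq_addr /= addKn.
  by congr (_ * d _); rewrite PoszD; ring.
(* The lower half of chi lists the tails of q backwards: index k - 1 - m carries the tail from m +
   1. *)
rewrite (reindex_inj rev_ord_inj) /= -sumrN; apply: eq_bigr => m _.
have mk := ltn_ord m; rewrite /chi_coef ifT; last lia.
rewrite mulNr (_ : (k - (k - m.+1) = m.+1)%N); last lia.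
by congr (- (_ * d _)); rewrite -subzn //; lia.
Qed.

(* The difference sequence d vanishes on the kq - 1 sites at and below 0 and on
   the kp - 1 sites above N, so its partial sums u have the right values at
   every overshoot of positive probability. *)
Lemma partial_sum_harmonic N (d : int -> C) (i : nat) :
  \sum_(1 <= j < k.+1) (p j + q j) = 1 ->
  (0 < i < N)%N ->
  \sum_(j < (2 * k)%N) chi_coef k p q j * d (i%:Z + j%:Z + 1 - k%:Z) = 0 ->
  (forall t : nat, (t < kq.-1)%N -> d (- t%:Z) = 0) ->
  (forall t : nat, (t < kp.-1)%N -> d (N%:Z + t%:Z + 1) = 0) ->
  let u n := \sum_(t < n) d (t%:Z + 1) in
  \sum_(1 <= l < k.+1) (p l * u (minn (i + l) N) + q l * u (i - l)%N) = u i.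
Proof.
move=> pq1 Hi rec dlow dhigh u.
have [kpk _ p0] := kp_spec; have [kqk _ q0] := kq_spec.
have up l : (l <= kp)%N -> u (minn (i + l) N) = u i + \sum_(m < l) d (i%:Z + m%:Z + 1).
  elim: l => [|l IHl] Hl.
    by rewrite addn0 (minn_idPl _) ?big_ord0 ?addr0 //; lia.
  rewrite big_ord_recr /= addrA -IHl; last lia.
  case: (ltnP (i + l) N) => ilN.
    rewrite !(minn_idPl _); [|lia..].
    by rewrite addnS /u big_ord_recr /= PoszD.
  rewrite !(minn_idPr _); [|lia..].
  have -> : i%:Z + l%:Z + 1 = N%:Z + (i + l - N)%N%:Z + 1 by lia.
  by rewrite dhigh ?addr0 //; lia.
have down l : (l <= kq)%N -> u (i - l)%N = u i - \sum_(m < l) d (i%:Z - m%:Z).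
  elim: l => [|l IHl] Hl; first by rewrite subn0 big_ord0 subr0.
  rewrite big_ord_recr /= opprD addrA -IHl; last lia.
  case: (ltnP l i) => li.
    have -> : (i - l = (i - l.+1).+1)%N by lia.
    rewrite /u big_ord_recr /=.
    have -> : (i - l.+1)%N%:Z + 1 = i%:Z - l%:Z by lia.
    by rewrite addrK.
  have -> : i%:Z - l%:Z = - (l - i)%N%:Z by lia.
  have -> : (i - l.+1 = i - l)%N by lia.
  by rewrite dlow ?subr0 //; lia.
have -> : u i = \sum_(1 <= l < k.+1) (p l + q l) * u i.
  by rewrite -mulr_suml pq1 mul1r.
rewrite -[RHS]addr0 -[X in _ = _ + X]rec sum_chi_coef -big_split /=.
apply: eq_big_nat => l Hl /=.
have -> : p l * u (minn (i + l) N) = p l * (u i + \sum_(m < l) d (i%:Z + m%:Z + 1)).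
  by case: (leqP l kp) => lk; [rewrite up | rewrite p0 ?mul0r //; lia].
have -> : q l * u (i - l)%N = q l * (u i - \sum_(m < l) d (i%:Z - m%:Z)).
  by case: (leqP l kq) => lk; [rewrite down | rewrite q0 ?mul0r //; lia].
by ring.
Qed.

End CharacteristicPolynomial.

(** * Accordion determinants as absorption probabilities *)

Section Accordion.
Variables (C : archiClosedFieldType) (k : nat) (p q : nat -> C) (N : nat).
Variable zs : seq C.
Hypothesis pq_ge0 : forall j : nat, (1 <= j <= k)%N -> 0 <= p j /\ 0 <= q j.
Hypothesis pq_sum : \sum_(1 <= j < k.+1) (p j + q j) = 1.
Hypothesis p_sum : 0 < \sum_(1 <= j < k.+1) p j.
Hypothesis q_sum : 0 < \sum_(1 <= j < k.+1) q j.
Hypothesis N_ge : (kp k p + kq k q <= N)%N.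
Hypothesis zs_uniq : uniq zs.
Hypothesis zsP : forall z : C, (z \in zs) = (z != 0) && root (chi k p q) z.

Notation kp := (kp k p).
Notation kq := (kq k q).
Notation chi := (chi k p q).
Notation rr := (rr k p q).
Notation A := (accordion k p q N).
Notation Z := (Zmat k p q N zs).
Notation col := (nth (0, 0%N) (Zcols k p q zs)).

(** Defined at every integer because the recurrence may read sites outside the rows of Z. Row b of Z
    sits at e = b + 2 - kq: the first kq - 1 rows at 2 - kq..0, the next N at 1..N, the last kp - 1
    above N. *)
Definition expo_comb (v : 'I_rr -> C) (e : int) : C :=
  \sum_c v c * (e%:~R ^+ (col c).2 * (col c).1 ^ e).

Lemma kp_bounds : (1 <= kp <= k)%N.
Proof. by have [] := kp_spec C k p q pq_ge0 p_sum. Qed.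

Lemma kq_bounds : (1 <= kq <= k)%N.
Proof. by have [] := kq_spec C k p q pq_ge0 q_sum. Qed.

Lemma rrE : rr = (kp + kq).-1.
Proof. by []. Qed.

Lemma Zcols_nth (c : 'I_rr) : (col c).1 != 0 /\ ((col c).2 < mup (col c).1 chi)%N.
Proof.
have : col c \in Zcols k p q zs by rewrite mem_nth // size_Zcols.
by rewrite (mem_expo_cols _ (fun z => mup z chi)) zsP => /andP[/andP[]].
Qed.

Lemma Zmat_mulmx (v : 'I_rr -> C) :
  Z *m (\col_c v c) = \col_b expo_comb v (b%:Z + (2 - kq%:Z)).
Proof.
apply/matrixP => b j; rewrite mulmx_col mxE; apply: eq_bigr => c _.
by rewrite mxE mulrC -!addrA.
Qed.

(** Column (z, l) contributes the l-th Euler iterate of chi at z, which vanishes because l is below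
    the multiplicity of z. *)
Lemma expo_comb_rec (v : 'I_rr -> C) (i : nat) :
  \sum_(j < (2 * k)%N) chi_coef k p q j * expo_comb v (i%:Z + j%:Z + 1 - k%:Z) = 0.
Proof.
under eq_bigr do rewrite mulr_sumr.
rewrite exchange_big big1 //= => c _; have [z0 lm] := Zcols_nth c.
have chi_size : (size chi <= 2 * k)%N by apply: size_poly.
have chi0 : chi != 0.
  by rewrite -size_poly_gt0 size_chi //; have := kp_bounds; lia.
transitivity (v c * ((col c).1 ^ (i%:Z + 1 - k%:Z) *
    (iter (col c).2 (eulerD C (i%:Z + 1 - k%:Z)) chi).[(col c).1])).
  rewrite -(horner_iter_eulerD _ _ _ _ _ _ z0 chi_size) mulr_sumr.
  apply: eq_bigr => j _; rewrite coef_poly ltn_ord mulrCA.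
  by have -> : i%:Z + j%:Z + 1 - k%:Z = j%:Z + (i%:Z + 1 - k%:Z) by ring.
rewrite (horner_iter_eulerD_eq0 _ _ _ _ _ (mup (col c).1 chi)) ?mulr0 //.
by rewrite -mup_geq.
Qed.

Lemma accordion_mulmx (i : nat) (W : nat -> C) (a : 'I_rr) j : (i <= N)%N ->
  (A i *m (\col_b W b)) a j =
  if (a < kq.-1)%N then W a
  else if (a == kq.-1 :> nat) then \sum_(t < i) W (kq.-1 + t)%N
  else W (N + a).-1.
Proof.
move=> iN; have kpk := kp_bounds; have kqk := kq_bounds.
have ar := ltn_ord a; have rE := rrE.
rewrite mulmx_col; under eq_bigr do rewrite mxE.
case: ifP => Ha; first by rewrite sum_ord_delta //; lia.
case: ifP => Ha'; last by rewrite sum_ord_delta //; lia.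
rewrite -(big_mkord xpredT (fun b => ((kq.-1 <= b) && (b < kq.-1 + i))%N%:R * W b)).
rewrite (@big_cat_nat _ _ _ kq.-1) //=; last by have := rrE; lia.
rewrite [X in X + _]big_nat [X in X + _]big1 ?add0r; last first.
  by move=> b Hb; rewrite leqNgt (_ : b < _)%N ?mul0r //; lia.
rewrite (@big_cat_nat _ _ _ (kq.-1 + i)%N) //=; [|lia..].
rewrite [X in _ + X]big_nat [X in _ + X]big1 ?addr0; last first.
  by move=> b Hb; rewrite (_ : (_ < _ + i)%N = false) ?andbF ?mul0r //; lia.
rewrite -{1}[kq.-1]add0n big_addn addnC addnK big_mkord.
by apply: eq_bigr => t _; rewrite leq_addl ltn_add2r ltn_ord mul1r addnC.
Qed.

Lemma kq_pred_lt : (kq.-1 < rr)%N.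
Proof. by have := kp_bounds; have := kq_bounds; have := rrE; lia. Qed.

Notation row0 := (Ordinal kq_pred_lt).

Definition partial_sum (v : 'I_rr -> C) (n : nat) : C :=
  \sum_(t < n) expo_comb v (t%:Z + 1).

Lemma accordion_Zmat_mulmx (v : 'I_rr -> C) (i : nat) : (i <= N)%N ->
  (A i *m Z *m (\col_c v c)) row0 0 = partial_sum v i.
Proof.
move=> iN; rewrite -mulmxA Zmat_mulmx.
rewrite (accordion_mulmx _ (fun b => expo_comb v (b%:Z + (2 - kq%:Z)))) //=.
rewrite ltnn eqxx; apply: eq_bigr => t _; congr expo_comb.
by have := kq_bounds; lia.
Qed.

Section BoundaryValues.
Variable v : 'I_rr -> C.
Hypothesis v_row : forall a, a != row0 -> (A N *m Z *m (\col_c v c)) a 0 = 0.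

Lemma expo_comb_low (t : nat) : (t < kq.-1)%N -> expo_comb v (- t%:Z) = 0.
Proof.
(* Row kq - 2 - t of the accordion picks the row of Z at e = -t. *)
move=> tk; have ar : (kq.-2 - t < rr)%N by have := kq_pred_lt; lia.
rewrite -(v_row (Ordinal ar)); last by rewrite -val_eqE /=; lia.
rewrite -mulmxA Zmat_mulmx.
rewrite (accordion_mulmx _ (fun b => expo_comb v (b%:Z + (2 - kq%:Z)))) //=.
rewrite ifT; last lia.
by congr expo_comb; lia.
Qed.

Lemma expo_comb_high (t : nat) :
  (t < kp.-1)%N -> expo_comb v (N%:Z + t%:Z + 1) = 0.
Proof.
have kqk := kq_bounds; have kpk := kp_bounds.
(* Row kq + t picks row N + kq + t - 1 of Z, which sits at e = N + t + 1. *)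
move=> tk; have ar : (kq + t < rr)%N by have := rrE; lia.
rewrite -(v_row (Ordinal ar)); last by rewrite -val_eqE /=; lia.
rewrite -mulmxA Zmat_mulmx.
rewrite (accordion_mulmx _ (fun b => expo_comb v (b%:Z + (2 - kq%:Z)))) //=.
rewrite !ifF; [|lia..].
by congr expo_comb; lia.
Qed.

(** Row [row0] is left free, so this serves both the adjugate column and a kernel vector of A_N
    Z. *)
Lemma partial_sum_limit (i : 'I_N.+1) :
  is_limit (fun m => (leap_trans k p q N ^+ m) i ord_max * partial_sum v N)
    (partial_sum v i).
Proof.
apply: (harmonic_limit _ _ _ _ _ pq_ge0 pq_sum p_sum).
  by rewrite /partial_sum big_ord0.
move=> j; case: (boolP (0 < j < N)%N) => Hj; last exact: leap_trans_absorbing.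
rewrite leap_trans_sum //.
apply: (partial_sum_harmonic _ _ _ _ pq_ge0 p_sum q_sum) => //.
- exact: expo_comb_rec.
- exact: expo_comb_low.
- exact: expo_comb_high.
Qed.

End BoundaryValues.

Lemma accordion_Zmat_det_neq0 : \det (A N *m Z) != 0.
Proof.
(* [det0P] provides a left kernel vector; transposing first makes it a right one. *)
rewrite -det_tr; apply/det0P => -[w w0 Hw].
pose v c := w 0 c.
have wv : w^T = \col_c v c by apply/matrixP => c j; rewrite !mxE ord1.
have Hv : A N *m Z *m (\col_c v c) = 0.
  by rewrite -wv -[A N *m Z]trmxK -trmx_mul Hw trmx0.
have v_row a : a != row0 -> (A N *m Z *m (\col_c v c)) a 0 = 0.
  by rewrite Hv mxE.
have uN : partial_sum v N = 0 by rewrite -accordion_Zmat_mulmx // Hv mxE.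
have u0 (i : nat) : (i <= N)%N -> partial_sum v i = 0.
  rewrite -ltnS => iN; apply/eqP; rewrite -normr_le0 -[_ <= _]negbK.
  rewrite -real_ltNge ?real0 ?normr_real //; apply/negP => gt0.
  (* The sequence is constantly 0 as u_N = 0; the tolerance |u_i| then gives |u_i| < |u_i|. *)
  have [n0 /(_ n0 (leqnn _))] := partial_sum_limit v v_row (Ordinal iN) _ gt0.
  by rewrite uN mulr0 sub0r normrN ltxx.
have d0 (t : nat) : (t < N)%N -> expo_comb v (t%:Z + 1) = 0.
  move=> tN; have := u0 _ tN; rewrite /partial_sum big_ord_recr /=.
  by rewrite -/(partial_sum v t) u0 ?add0r // ltnW.
have kqk := kq_bounds; have kpk := kp_bounds.
have v0 c : v c = 0.
  apply: (expo_cols_free _ (fun z => mup z chi) zs _ v (2 - kq%:Z)) => //.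
  - by rewrite zsP eqxx.
  - exact: size_Zcols.
  (* The first rr rows of Z suffice: kq - 1 of them are boundary sites, the others are the
     increments at e = 1..kp, and kp <= N. *)
  move=> b br; change (expo_comb v (b%:Z + (2 - kq%:Z)) = 0).
  case: (ltnP b kq.-1) => bk.
    have -> : b%:Z + (2 - kq%:Z) = - (kq.-2 - b)%N%:Z by lia.
    by apply: expo_comb_low => //; lia.
  have -> : b%:Z + (2 - kq%:Z) = (b - kq.-1)%N%:Z + 1 by lia.
  by apply: d0; have := rrE; lia.
by case/eqP: w0; apply/matrixP => i c; rewrite ord1 mxE; apply: v0.
Qed.

(* Cramer: the matrices A_i Z differ only in row kq - 1, so expanding along it
   uses column kq - 1 of the adjugate of A_N Z for every i. *)
Lemma det_accordion_Zmat (i : nat) : (i <= N)%N ->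
  \det (A i *m Z) = partial_sum (fun c => (\adj (A N *m Z)) c row0) i.
Proof.
move=> iN; rewrite -accordion_Zmat_mulmx // mulmx_col.
rewrite (expand_det_row _ row0); apply: eq_bigr => c _; rewrite [(\adj _) c row0]mxE.
congr (_ * _); rewrite /cofactor; congr (_ * \det _).
apply/matrixP => a b; rewrite !mxE; apply: eq_bigr => l _; congr (_ * _).
rewrite !mxE (_ : (lift row0 a == kq.-1 :> nat) = false) //.
by apply/negbTE; have := neq_lift row0 a; rewrite eq_sym -val_eqE.
Qed.

(** These are off-diagonal entries of B adj(B) = det(B) I for B = A_N Z. *)
Lemma adj_column_row a : a != row0 ->
  (A N *m Z *m (\col_c (\adj (A N *m Z)) c row0)) a 0 = 0.
Proof.
move=> a0; rewrite mulmx_col.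
have := congr1 (fun M : 'M_rr => M a row0) (mul_mx_adj (A N *m Z)).
by rewrite /= [RHS]mxE [LHS]mxE (negPf a0).
Qed.

Lemma absorb_prob_accordion (i : 'I_N.+1) :
  absorb_prob_is k p q i (\det (A i *m Z) / \det (A N *m Z)).
Proof.
move=> eps eps0; have det0 := accordion_Zmat_det_neq0.
have detN0 : 0 < `|\det (A N *m Z)| by rewrite normr_gt0.
(* The limit concerns T^n(i, N) det(A_N Z); scaling the tolerance by |det(A_N Z)| allows the
   division. *)
have [n0 Hn0] := partial_sum_limit _ adj_column_row i _ (mulr_gt0 eps0 detN0).
exists n0 => n /Hn0; rewrite -!det_accordion_Zmat //; last by rewrite -ltnS.
by move=> Hn; rewrite -(ltr_pM2r detN0) -normrM mulrBl divfK.
Qed.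

End Accordion.

Theorem mainTheorem2 (C : archiClosedFieldType) (k : nat) (p q : nat -> C)
    (N : nat) (zs : seq C) :
  (1 <= k)%N ->
  (forall j : nat, (1 <= j <= k)%N -> 0 <= p j /\ 0 <= q j) ->
  \sum_(1 <= j < k.+1) (p j + q j) = 1 ->
  0 < \sum_(1 <= j < k.+1) p j ->
  0 < \sum_(1 <= j < k.+1) q j ->
  (kp k p + kq k q <= N)%N ->
  uniq zs ->
  (forall z : C, (z \in zs) = (z != 0) && root (chi k p q) z) ->
  \det (accordion k p q N N *m Zmat k p q N zs) != 0 /\
  (forall i : 'I_N.+1,
     absorb_prob_is k p q i
       (\det (accordion k p q N i *m Zmat k p q N zs)
        / \det (accordion k p q N N *m Zmat k p q N zs))).
Proof.
move=> _ pq_ge0 pq_sum p_sum q_sum N_ge zs_uniq zsP; split.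
  exact: accordion_Zmat_det_neq0.
by move=> i; apply: absorb_prob_accordion.
Qed.
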